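(* Let $r>s$ be integers with $s\ge2$ and $r\ge4$. Let $G=\overline{\langle a_1,\dots,a_r\rangle}\subset W$ be the closed subgroup topologically generated by the elements $a_1,\dots,a_r\in W$ determined by $a_1=\sigma$, $a_{s+1}=(a_s,a_r)$, and $a_i=(a_{i-1},1)$ for $i\ne1,s+1$, and let $N:=\operatorname{Norm}_W(G)$. Define $w_1:=(a_s,a_s)$ and $w_{i+1}:=(w_i,w_i)$ for all $i\ge1$. These elements lie in $N$, have order two and converge to $1$, and the map $$\varphi:\prod_{i=1}^\infty\mathbb{F}_2\to N,\qquad (k_1,k_2,\dots)\mapsto w_1^{k_1}w_2^{k_2}\cdots$$ (limit of the finite products) is well-defined. Then $\varphi$ induces an isomorphism of groups $$\bar\varphi:\prod_{i=1}^\infty\mathbb{F}_2\ \xrightarrow{\ \sim\ }\ N/G.$$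
   Context: $T$ is the infinite rooted binary tree whose vertices are the finite words over $\{0,1\}$, with root the empty word, each word $t$ being joined by an edge to $t0$ and $t1$. $W:=\operatorname{Aut}(T)$ is its automorphism group, a profinite group as the inverse limit of the finite groups $W_n=\operatorname{Aut}(T_n)$, where $T_n\subset T$ is the subtree of words of length $\le n$. For $u,v\in W$, $(u,v)\in W$ denotes the automorphism $0t\mapsto 0\,u(t)$, $1t\mapsto 1\,v(t)$ for all words $t$; $\sigma\in W$ is the automorphism of order $2$ with $0t\mapsto 1t$ and $1t\mapsto 0t$. Thus $W=(W\times W)\rtimes\langle\sigma\rangle$. The recursion relations for $a_1,\dots,a_r$ have a unique solution in $W$. $\operatorname{Norm}_W(G)$ is the normalizer of $G$ in $W$. The map $\bar\varphi$ is the composite of $\varphi$ with the projection $N\to N/G$ ($\varphi$ itself is not a homomorphism). *)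

(* Defs.v *)
From HB Require Import structures.
From mathcomp Require Import all_boot all_order all_algebra.
From mathcomp Require Import all_classical all_reals topology.
From mathcomp Require Import zify.

Set Implicit Arguments.
Unset Strict Implicit.
Unset Printing Implicit Defensive.

Local Open Scope classical_set_scope.
Local Open Scope group_scope.

(** * The rooted binary tree and its automorphism group *)

(* The letters 0 and 1 are [false] and [true]; the root is [[::]]. *)
Definition word := seq bool.

Definition child (t u : word) : Prop := exists b, u = rcons t b.

Definition edge (t u : word) : Prop := child t u \/ child u t.

Definition is_tree_aut (f : word -> word) : Prop :=
  [/\ bijective f, f [::] = [::] & forall t u, edge (f t) (f u) <-> edge t u].

Record treeAut := TreeAut {
  aut_fun :> word -> word ;
  aut_funP : is_tree_aut aut_fun }.

Lemma treeAut_eq (x y : treeAut) : x =1 y -> x = y.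
Proof.
case: x y => [f fP] [g gP] /= /funext fg; subst g.
by congr TreeAut; exact: Prop_irrelevance.
Qed.

Lemma is_tree_aut_id : is_tree_aut id.
Proof. by split => //; exists id. Qed.

Lemma is_tree_aut_comp f g :
  is_tree_aut f -> is_tree_aut g -> is_tree_aut (f \o g).
Proof.
move=> [fb f0 fe] [gb g0 ge]; split; first exact: bij_comp.
  by rewrite /= g0.
by move=> t u; rewrite /= fe ge.
Qed.

Lemma tree_aut_inv_subproof f : is_tree_aut f ->
  {g | [/\ is_tree_aut g, cancel f g & cancel g f]}.
Proof.
move=> [fb f0 fe]; apply: cid; case: (fb) => g fK gK.
exists g; split => //; split; first by exists f.
  by rewrite -[LHS]/(g [::]) -{1}f0 fK.
by move=> t u; rewrite -fe !gK.
Qed.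

Lemma child_cons b c t u : child (b :: t) (c :: u) <-> b = c /\ child t u.
Proof.
split; first by move=> [d [-> ->]]; split => //; exists d.
by move=> [-> [d ->]]; exists d.
Qed.

Lemma child_nil_cons b u : child [::] (b :: u) <-> u = [::].
Proof. by split; [move=> [c [_ ->]] | move=> ->; exists b]. Qed.

Lemma child_nil t : ~ child t [::].
Proof. by case=> b; case: t. Qed.

Lemma edge_nil : ~ edge [::] [::].
Proof. by case=> /child_nil. Qed.

Lemma edge_cons b c t u : edge (b :: t) (c :: u) <-> b = c /\ edge t u.
Proof.
split.
  by case=> /child_cons [-> tu]; split => //; [left | right].
by move=> [-> [tu | ut]]; [left | right]; apply/child_cons.
Qed.

Lemma edge_nil_cons b u : edge [::] (b :: u) <-> u = [::].
Proof.
split; first by case=> [/child_nil_cons | /child_nil].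
by move=> u0; left; apply/child_nil_cons.
Qed.

Lemma edge_cons_nil b u : edge (b :: u) [::] <-> u = [::].
Proof.
split; first by case=> [/child_nil | /child_nil_cons].
by move=> u0; right; apply/child_nil_cons.
Qed.

Lemma tree_aut_eq0 f t : is_tree_aut f -> f t = [::] <-> t = [::].
Proof.
move=> [fb f0 _]; split => [ft | ->//].
by apply: (bij_inj fb); rewrite ft f0.
Qed.

(* An automorphism swaps ([c = true]) or fixes the two subtrees below the root,
   and acts on each of them. *)
Lemma is_tree_aut_node c (x : bool -> word -> word) :
  (forall b, is_tree_aut (x b)) ->
  is_tree_aut (fun t => if t is b :: t' then (c (+) b) :: x b t' else [::]).
Proof.
move=> xP; split => //.
- have inv b := tree_aut_inv_subproof (xP b).
  exists (fun t => if t is b :: t'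
    then (c (+) b) :: sval (inv (c (+) b)) t' else [::]).
    case=> [//|b t]; rewrite addKb; congr (_ :: _).
    by case: (svalP (inv b)).
  case=> [//|b t]; rewrite addKb; congr (_ :: _).
  by case: (svalP (inv (c (+) b))).
- move=> [|b t] [|d u] //.
  + by rewrite !edge_nil_cons tree_aut_eq0.
  + by rewrite !edge_cons_nil tree_aut_eq0.
  + rewrite !edge_cons; split=> [] [].
      move=> /addbI bd; subst d => xtu; split => //.
      by case: (xP b) => _ _ e; apply/e.
    move=> bd; subst d => tu; split => //.
    by case: (xP b) => _ _ e; apply/e.
Qed.

HB.instance Definition _ := gen_eqMixin treeAut.
HB.instance Definition _ := gen_choiceMixin treeAut.

Definition aut_one : treeAut := TreeAut is_tree_aut_id.

Definition aut_mul (x y : treeAut) : treeAut :=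
  TreeAut (is_tree_aut_comp (aut_funP x) (aut_funP y)).

Definition aut_inv (x : treeAut) : treeAut :=
  TreeAut (let: And3 P _ _ := svalP (tree_aut_inv_subproof (aut_funP x)) in P).

Lemma aut_mulA : associative aut_mul.
Proof. by move=> x y z; apply: treeAut_eq. Qed.

Lemma aut_mul1 : left_id aut_one aut_mul.
Proof. by move=> x; apply: treeAut_eq. Qed.

Lemma aut_mulr1 : right_id aut_one aut_mul.
Proof. by move=> x; apply: treeAut_eq. Qed.

Lemma aut_mulV : left_inverse aut_one aut_inv aut_mul.
Proof.
move=> x; apply: treeAut_eq => t /=.
by case: (svalP (tree_aut_inv_subproof (aut_funP x))).
Qed.

Lemma aut_mulrV : right_inverse aut_one aut_inv aut_mul.
Proof.
move=> x; apply: treeAut_eq => t /=.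
by case: (svalP (tree_aut_inv_subproof (aut_funP x))).
Qed.

(* [x * y] is the composite [x \o y]: automorphisms act on words from the
   left. *)
HB.instance Definition _ := isGroup.Build treeAut
  aut_mulA aut_mul1 aut_mulr1 aut_mulV aut_mulrV.

(* (u, v) : 0t |-> 0 u(t), 1t |-> 1 v(t) *)
Definition pair_fun (u v : word -> word) (t : word) : word :=
  match t with
  | [::] => [::]
  | false :: t' => false :: u t'
  | true :: t' => true :: v t'
  end.

Lemma is_tree_aut_pair u v :
  is_tree_aut u -> is_tree_aut v -> is_tree_aut (pair_fun u v).
Proof.
move=> uP vP.
have /(is_tree_aut_node false) : forall b, is_tree_aut (if b then v else u).
  by case.
by congr is_tree_aut; apply/funext => -[|[] t].
Qed.

Definition aut_pair (u v : treeAut) : treeAut :=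
  TreeAut (is_tree_aut_pair (aut_funP u) (aut_funP v)).

Definition swap_fun (t : word) : word :=
  if t is b :: t' then ~~ b :: t' else [::].

Lemma is_tree_aut_swap : is_tree_aut swap_fun.
Proof.
have /(is_tree_aut_node true) : forall b : bool, is_tree_aut id.
  by move=> _; exact: is_tree_aut_id.
by congr is_tree_aut; apply/funext => -[|[] t].
Qed.

Definition aut_swap : treeAut := TreeAut is_tree_aut_swap.

(** * The profinite topology *)

(* [x] and [y] have the same restriction to the words of length at most [n],
   i.e. the same image in the finite group of automorphisms of the subtree of
   these words.  The cosets of the kernels of these restriction maps form
   neighbourhood bases for the inverse limit topology. *)
Definition same_upto (n : nat) (x y : treeAut) : Prop :=
  forall t : word, (size t <= n)%N -> x t = y t.

Definition aut_nbhs (x : treeAut) : set (set treeAut) :=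
  [set A | exists n, [set y | same_upto n x y] `<=` A].

HB.instance Definition _ := hasNbhs.Build treeAut aut_nbhs.

Lemma aut_nbhs_filter (x : treeAut) : ProperFilter (nbhs x).
Proof.
apply: Build_ProperFilter_ex.
  by move=> A [n nA]; exists x; apply: nA.
split; first by exists 0%N.
  move=> A B [n nA] [m mB]; exists (maxn n m) => y xy; split.
    by apply: nA => t tn; apply: xy; rewrite leq_max tn.
  by apply: mB => t tm; apply: xy; rewrite leq_max tm orbT.
by move=> A B AB [n nA]; exists n; apply: subset_trans AB.
Qed.

Lemma aut_nbhs_singleton (x : treeAut) (A : set treeAut) : nbhs x A -> A x.
Proof. by move=> [n nA]; apply: nA. Qed.

Lemma aut_nbhs_nbhs (x : treeAut) (A : set treeAut) :
  nbhs x A -> nbhs x (nbhs^~ A).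
Proof.
move=> [n nA]; exists n => y xy; exists n => z yz; apply: nA => t tn.
by rewrite xy// yz.
Qed.

HB.instance Definition _ := Nbhs_isNbhsTopological.Build treeAut
  aut_nbhs_filter aut_nbhs_singleton aut_nbhs_nbhs.

HB.instance Definition _ := isPointed.Build treeAut 1.

Lemma treeAut_hausdorff : hausdorff_space treeAut.
Proof.
move=> x y xy; apply: treeAut_eq => t.
have nb z : nbhs z [set y | same_upto (size t) z y] by exists (size t).
by have [z [xz yz]] := xy _ _ (nb x) (nb y); rewrite xz// yz.
Qed.

(** * Subgroups, normalizers and quotients of arbitrary groups *)

Definition subgroup (gT : groupType) (H : set gT) : Prop :=
  [/\ H 1, (forall x y, H x -> H y -> H (x * y)) & (forall x, H x -> H x^-1)].

Definition generated (gT : groupType) (S : set gT) : set gT :=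
  smallest (@subgroup gT) S.

Definition normalizer (gT : groupType) (G : set gT) : set gT :=
  [set x | [set g ^ x | g in G] = G].

Definition left_coset (gT : groupType) (G : set gT) (x : gT) : set gT :=
  [set x * g | g in G].

(* The group law of [N / G] is the product of cosets as subsets of [gT]. *)
Definition quotient (gT : groupType) (N G : set gT) : set (set gT) :=
  [set left_coset G x | x in N].

Definition coset_mul (gT : groupType) (A B : set gT) : set gT :=
  [set x * y | x in A & y in B].

Lemma coset_mulE (gT : groupType) (G : set gT) (x y : gT) :
  subgroup G -> normalizer G y ->
  coset_mul (left_coset G x) (left_coset G y) = left_coset G (x * y).
Proof.
move=> [G1 GM GV] Ny; apply/seteqP; split => z.
  move=> [_ [g Gg <-] [_ [h Gh <-] <-]]; exists (g ^ y * h).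
    by apply: GM => //; rewrite -Ny; exists g.
  by rewrite /conjg !mulgA mulgK.
move=> [g Gg <-]; exists x; first by exists 1 => //; rewrite mulg1.
by exists (y * g); [exists g | rewrite mulgA].
Qed.

(** * The group [G] and the map [phi] *)

(* Only the values [a 1, ..., a r] matter. *)
Definition recursion (r s : nat) (a : nat -> treeAut) : Prop :=
  [/\ a 1%N = aut_swap,
      a s.+1 = aut_pair (a s) (a r) &
      forall i, (1 < i <= r)%N -> i != s.+1 -> a i = aut_pair (a i.-1) 1].

Fixpoint recursion_fun (r s i : nat) (t : word) : word :=
  match t with
  | [::] => [::]
  | b :: t' =>
    if (i <= 1)%N then ~~ b :: t'
    else if b then true :: (if i == s.+1 then recursion_fun r s r t' else t')
    else false :: recursion_fun r s i.-1 t'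
  end.

Lemma is_tree_aut_recursion_fun r s i : is_tree_aut (recursion_fun r s i).
Proof.
have fK j : involutive (recursion_fun r s j).
  move=> t; elim: t j => [//|b t IH] j /=.
  case j1: (j <= 1)%N; rewrite /= ?j1 ?negbK//.
  by case: b; case js: (j == s.+1); rewrite /= ?j1 ?js ?IH.
have f0 j t : recursion_fun r s j t = [::] <-> t = [::].
  by split=> [e|->//]; rewrite -(fK j t) e.
split => //; first exact: Bijective (fK i) (fK i).
move=> t; elim: t i => [|b t IH] i [|c u] //.
- rewrite -[recursion_fun _ _ _ [::]]/[::] edge_nil_cons /=.
  case: ifP => _; first by rewrite edge_nil_cons.
  by case: c; [case: ifP => _|]; rewrite edge_nil_cons;
     first [exact: iff_refl | exact: f0].
- rewrite -[recursion_fun _ _ _ [::]]/[::] edge_cons_nil /=.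
  case: ifP => _; first by rewrite edge_cons_nil.
  by case: b; [case: ifP => _|]; rewrite edge_cons_nil;
     first [exact: iff_refl | exact: f0].
- rewrite edge_cons /=; case: ifP => _.
    by rewrite edge_cons; split=> -[bc tu]; split => //;
       [apply: negb_inj | rewrite bc].
  by case: b; case: c; rewrite edge_cons; split=> -[] // _;
     try case: ifP => _ //; rewrite ?IH.
Qed.

Lemma recursion_exists r s : (0 < s)%N -> exists a, recursion r s a.
Proof.
move=> s0; exists (fun i => TreeAut (is_tree_aut_recursion_fun r s i)); split.
- by apply: treeAut_eq => -[].
- by apply: treeAut_eq => -[//|b t] /=; rewrite ltnNge s0/= eqxx; case: b.
- move=> i /andP[i1 _] /negbTE is1; apply: treeAut_eq => -[//|b t] /=.
  by rewrite leqNgt i1/= is1; case: b.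
Qed.

Lemma recursion_unique r s a a' : (0 < s < r)%N ->
  recursion r s a -> recursion r s a' ->
  forall i, (1 <= i <= r)%N -> a i = a' i.
Proof.
move=> /andP[s0 sr] [a1 as1 ai] [b1 bs1 bi] i ir.
apply: treeAut_eq => t; elim: t i ir => [|b t IH] i ir.
  by case: (aut_funP (a i)) => _ -> _; case: (aut_funP (a' i)) => _ -> _.
have [->|i1] := eqVneq i 1%N; first by rewrite a1 b1.
have [->|is1] := eqVneq i s.+1.
  by rewrite as1 bs1 /=; case: b; rewrite IH//; lia.
have ri : (1 < i <= r)%N by lia.
rewrite (ai _ ri is1) (bi _ ri is1) /=; case: b => //.
by congr (_ :: _); apply: IH; lia.
Qed.

Definition closed_group (r : nat) (a : nat -> treeAut) : set treeAut :=
  closure (generated [set a i | i in [set i | (1 <= i <= r)%N]]).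

(* [diag_seq x 1 = (x, x)] and [diag_seq x i.+1] is the pair of twice
   [diag_seq x i]. *)
Definition diag_seq (x : treeAut) (i : nat) : treeAut :=
  iter i (fun u => aut_pair u u) x.

(* The factors are w_1, w_2, ...; [k i] is the exponent of w_(i+1). *)
Definition partial_prod (w : nat -> treeAut) (k : nat -> 'F_2) (n : nat) :
    treeAut :=
  \prod_(0 <= i < n) w i.+1 ^+ k i.

Definition phi (w : nat -> treeAut) (k : nat -> 'F_2) : treeAut :=
  limn (partial_prod w k).

(* Main.v *)
(* Let sgn_n, with values in F_2, be the sign of the action on the words of
   length n.  For 1 <= i, n <= r one has sgn_n(a_i) = 1 exactly when i = n, and
   modulo the closed normal subgroup L = {g in G | (g, 1) in G} the group G is
   generated by the commuting involutions a_s and a_r, all other a_i being in L.  Hence sgn_s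
   and sgn_r determine the class modulo L, and (u, v) lies in G exactly when
   u, v do, sgn_s(u) = sgn_r(v) and sgn_r(u) = sgn_s(v).

   With D(x) = (x, x) it follows that D maps N to N, that D(g) lies in G iff
   g lies in G and sgn_s(g) = sgn_r(g), and that N = D(N) G.  More
   precisely every element of N is a_s^k D(n) g with n in N, g in G and
   sgn_s(g) = sgn_r(g), hence D(g) in G; iterating this gives surjectivity.  Since
   phi(k) = D(a_s^(k_1) phi(k')) with k' the shifted sequence, and the signs of
   elements D(x) vanish, phi(l) in phi(k) G forces k_1 = l_1 and
   phi(l') in phi(k') G. *)

Require Import Defs.
From mathcomp Require Import all_boot all_order all_algebra.
From mathcomp Require Import all_classical all_reals topology.
From mathcomp Require Import zify.

Set Implicit Arguments.
Unset Strict Implicit.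
Unset Printing Implicit Defensive.

Local Open Scope classical_set_scope.
Local Open Scope group_scope.

(** * Sections and signs of tree automorphisms *)

Lemma aut_bij (x : treeAut) : bijective x.
Proof. by case: (aut_funP x). Qed.

Lemma aut_nil (x : treeAut) : x [::] = [::].
Proof. by case: (aut_funP x). Qed.

Lemma autM (x y : treeAut) t : (x * y) t = x (y t).
Proof. by []. Qed.

(** The letter 0 suffices: 1 moves the opposite way, by [head_aut_true]. The default of [head] is
    never reached, since only the root maps to the root. *)
Definition swapped (x : treeAut) : bool := head false (x [:: false]).

Definition sec_fun (x : treeAut) (b : bool) (t : word) : word :=
  behead (x (b :: t)).

(** Edges that avoid the root preserve the first letter, and a path of such edges joins [[:: b]] to
    [b :: t]. *)
Lemma aut_head (x : treeAut) b t : exists u, x (b :: t) = head false (x [:: b]) :: u.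
Proof.
have x0 c u : x (c :: u) <> [::].
  by rewrite -(aut_nil x) => /(bij_inj (aut_bij x)).
elim/last_ind: t => [|t c [u IH]].
  by case: (x [:: b]) (x0 b [::]) => // d u _; exists u.
have : edge (x (b :: t)) (x (b :: rcons t c)).
  by case: (aut_funP x) => _ _ e; apply/e; left; exists c.
case: (x (b :: rcons t c)) (x0 b (rcons t c)) => // d v _.
by rewrite IH edge_cons => -[<- _]; exists v.
Qed.

Lemma head_aut_true (x : treeAut) :
  head false (x [:: true]) = ~~ head false (x [:: false]).
Proof.
have [u1 e1] := aut_head x true [::].
have [u0 e0] := aut_head x false [::].
have e b u : x [:: b] = head false (x [:: b]) :: u -> u = [::].
  move=> xb; have : edge (x [::]) (x [:: b]).
    by case: (aut_funP x) => _ _ e; apply/e; left; exists b.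
  by rewrite aut_nil xb edge_nil_cons.
have : x [:: true] <> x [:: false] by move=> /(bij_inj (aut_bij x)).
rewrite e1 e0 (e _ _ e0) (e _ _ e1) /=.
by do 2 case: (head _ _).
Qed.

Lemma autE (x : treeAut) b t : x (b :: t) = (swapped x (+) b) :: sec_fun x b t.
Proof.
have [u e] := aut_head x b t; rewrite /sec_fun e /=; congr (_ :: _).
by case: b {e} => /=; rewrite ?head_aut_true ?addbT ?addbF.
Qed.

Lemma is_tree_aut_sec x b : is_tree_aut (sec_fun x b).
Proof.
have [[y xK yK] x0 xe] := aut_funP x.
have yE t : y ((swapped x (+) b) :: t) = b :: behead (y ((swapped x (+) b) :: t)).
  case e: (y _) => [|c u] /=.
    by move: (yK ((swapped x (+) b) :: t)); rewrite e x0.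
  congr (_ :: _); have := yK ((swapped x (+) b) :: t); rewrite e autE.
  by case=> /addbI.
split.
- exists (fun t => behead (y ((swapped x (+) b) :: t))) => t.
    by rewrite -autE xK.
  by rewrite /sec_fun -yE yK.
- have : edge (x [::]) (x [:: b]) by apply/xe; left; exists b.
  by rewrite x0 autE edge_nil_cons.
- have e c v w : edge (c :: v) (c :: w) <-> edge v w.
    by rewrite edge_cons; split=> [[]|].
  by move=> t u; rewrite -(e (swapped x (+) b)) -!autE xe e.
Qed.

Definition sec (x : treeAut) (b : bool) : treeAut := TreeAut (is_tree_aut_sec x b).

Lemma aut_cons (x : treeAut) b t : x (b :: t) = (swapped x (+) b) :: sec x b t.
Proof. exact: autE. Qed.

Lemma aut_node_eq (x : treeAut) c (u : bool -> treeAut) :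
  (forall b t, x (b :: t) = (c (+) b) :: u b t) ->
  swapped x = c /\ forall b, sec x b = u b.
Proof.
move=> xE; have xc : swapped x = c.
  by move: (xE false [::]); rewrite aut_cons => -[/addIb].
split=> // b; apply: treeAut_eq => t.
by move: (xE b t); rewrite aut_cons => -[].
Qed.

Lemma aut_eqP (x y : treeAut) :
  swapped x = swapped y -> (forall b, sec x b = sec y b) -> x = y.
Proof.
move=> e0 e; apply: treeAut_eq => -[|b t]; first by rewrite !aut_nil.
by rewrite !aut_cons e0 e.
Qed.

Lemma swapped_secM (x y : treeAut) :
  swapped (x * y) = swapped x (+) swapped y /\
  forall b, sec (x * y) b = sec x (swapped y (+) b) * sec y b.
Proof. by apply: aut_node_eq => b t; rewrite autM !aut_cons addbA. Qed.

Lemma swappedM (x y : treeAut) : swapped (x * y) = swapped x (+) swapped y.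
Proof. by case: (swapped_secM x y). Qed.

Lemma secM (x y : treeAut) b :
  sec (x * y) b = sec x (swapped y (+) b) * sec y b.
Proof. by case: (swapped_secM x y). Qed.

Lemma swapped1 : swapped 1 = false. Proof. by []. Qed.

Lemma sec1 b : sec 1 b = 1.
Proof. by have [_ ->] := @aut_node_eq 1 false (fun=> 1) (fun _ _ => erefl). Qed.

Lemma swappedV (x : treeAut) : swapped x^-1 = swapped x.
Proof.
apply: (@addbI (swapped x)).
by rewrite -swappedM mulgV addbb swapped1.
Qed.

Lemma secV (x : treeAut) b : sec x^-1 b = (sec x (swapped x (+) b))^-1.
Proof.
apply: (mulgI (sec x (swapped x (+) b))).
by rewrite mulgV -{1}swappedV -secM mulgV sec1.
Qed.

Lemma sec_swap b : sec aut_swap b = 1.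
Proof. by have [_ ->] := @aut_node_eq aut_swap true (fun=> 1) (fun _ _ => erefl). Qed.

Lemma swapped_pair u v : swapped (aut_pair u v) = false. Proof. by []. Qed.

Lemma sec_pair u v b : sec (aut_pair u v) b = if b then v else u.
Proof.
by have [_ ->] := @aut_node_eq (aut_pair u v) false (fun b => if b then v else u)
  ltac:(by case).
Qed.

Lemma aut_pairE (x : treeAut) :
  swapped x = false -> x = aut_pair (sec x false) (sec x true).
Proof. by move=> x0; apply: aut_eqP => // b; rewrite sec_pair; case: b. Qed.

Lemma aut_pair_cons u v b t :
  aut_pair u v (b :: t) = b :: (if b then v else u) t.
Proof. by case: b. Qed.

Lemma pairM u v u' v' :
  aut_pair u v * aut_pair u' v' = aut_pair (u * u') (v * v').
Proof. by apply: treeAut_eq => -[|[] t]. Qed.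

Lemma pair11 : aut_pair 1 1 = 1.
Proof. by apply: treeAut_eq => -[|[] t]. Qed.

Lemma pairV u v : (aut_pair u v)^-1 = aut_pair u^-1 v^-1.
Proof. by apply: mulg1_eq; rewrite pairM !mulgV pair11. Qed.

Lemma pairJ u v u' v' : aut_pair u v ^ aut_pair u' v' = aut_pair (u ^ u') (v ^ v').
Proof. by rewrite !conjgE pairV !pairM. Qed.

Lemma swapK : aut_swap * aut_swap = 1.
Proof. by apply: treeAut_eq => -[|[] t]. Qed.

Lemma swapV : aut_swap^-1 = aut_swap.
Proof. exact: mulg1_eq swapK. Qed.

Lemma pair_swap u v : aut_pair u v ^ aut_swap = aut_pair v u.
Proof. by rewrite conjgE swapV; apply: treeAut_eq => -[|[] t]. Qed.

(* The sign of the permutation induced by [x] on the words of length [n.+1]. *)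
Fixpoint sgn (n : nat) (x : treeAut) : bool :=
  if n is m.+1 then sgn m (sec x false) (+) sgn m (sec x true) else swapped x.

Lemma sgnM n x y : sgn n (x * y) = sgn n x (+) sgn n y.
Proof.
elim: n x y => [|n IH] x y /=; first exact: swappedM.
rewrite !secM !IH; case: (swapped y) => /=; last by rewrite addbACA.
by rewrite addbACA [X in X (+) _]addbC.
Qed.

Lemma sgn1 n : sgn n 1 = false.
Proof. by elim: n => //= n IH; rewrite !sec1 IH. Qed.

Lemma sgnV n x : sgn n x^-1 = sgn n x.
Proof. by apply: (@addbI (sgn n x)); rewrite -sgnM mulgV addbb sgn1. Qed.

Lemma sgnX n x (b : bool) : sgn n (x ^+ b) = b && sgn n x.
Proof. by case: b => //=; rewrite sgn1. Qed.

Lemma sgnJ n x y : sgn n (x ^ y) = sgn n x.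
Proof. by rewrite conjgE !sgnM sgnV addbCA addbb addbF. Qed.

Lemma sgn_pair n u v : sgn n.+1 (aut_pair u v) = sgn n u (+) sgn n v.
Proof. by rewrite /= !sec_pair. Qed.

Lemma size_aut (x : treeAut) t : size (x t) = size t.
Proof. elim: t x => [|b t IH] x; first by rewrite aut_nil.
by rewrite aut_cons -[LHS]/(size (sec x b t)).+1 IH. Qed.

(** * Agreement up to a level, closed sets and limits *)

Section SameUpto.
Implicit Types (n : nat) (x y : treeAut).

Lemma same_upto_sym n x y : same_upto n x y -> same_upto n y x.
Proof. by move=> xy t tn; rewrite xy. Qed.

Lemma same_upto_trans n y x z :
  same_upto n x y -> same_upto n y z -> same_upto n x z.
Proof. by move=> xy yz t tn; rewrite xy// yz. Qed.

Lemma same_upto_leq m n x y : m <= n -> same_upto n x y -> same_upto m x y.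
Proof. by move=> mn xy t tm; apply: xy; apply: leq_trans mn. Qed.

Lemma same_uptoM n x y x' y' : same_upto n x x' -> same_upto n y y' ->
  same_upto n (x * y) (x' * y').
Proof. by move=> xx yy t tn; rewrite !autM yy// xx// size_aut. Qed.

Lemma same_uptoV n x y : same_upto n x y -> same_upto n x^-1 y^-1.
Proof.
move=> xy t tn; apply: (bij_inj (aut_bij x)).
by rewrite -autM mulgV xy ?size_aut// -autM mulgV.
Qed.

Lemma same_uptoJ n x y x' y' : same_upto n x x' -> same_upto n y y' ->
  same_upto n (x ^ y) (x' ^ y').
Proof.
by move=> xx yy; rewrite !conjgE; do 2?apply: same_uptoM => //; exact: same_uptoV.
Qed.

Lemma same_upto_pair n u v u' v' : same_upto n u u' -> same_upto n v v' ->
  same_upto n.+1 (aut_pair u v) (aut_pair u' v').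
Proof. by move=> uu vv [|[] t] //= tn; rewrite ?uu ?vv. Qed.

Lemma same_upto_swapped n x y : same_upto n.+1 x y -> swapped x = swapped y.
Proof. by move=> /(_ [:: false] isT); rewrite !aut_cons => -[/addIb]. Qed.

Lemma same_upto_sec n x y b : same_upto n.+1 x y -> same_upto n (sec x b) (sec y b).
Proof.
by move=> xy t tn; have := xy (b :: t) tn; rewrite !aut_cons => -[].
Qed.

(** [sgn m] lives on level [m.+1], whence the strict inequality. Signs are locally constant, so sign
    conditions pass to closures. *)
Lemma same_upto_sgn n m x y : m < n -> same_upto n x y -> sgn m x = sgn m y.
Proof.
elim: m n x y => [|m IH] [|n] x y //= mn xy; first exact: same_upto_swapped xy.
by congr (_ (+) _); apply: IH mn _; apply: same_upto_sec.
Qed.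

Lemma closure_autP (A : set treeAut) x :
  closure A x <-> forall n, exists2 y, A y & same_upto n x y.
Proof.
split=> [Ax n|Ax B [n nB]].
  by have [y [Ay xy]] := Ax [set y | same_upto n x y] (ex_intro _ n (fun _ => id));
    exists y.
by have [y Ay xy] := Ax n; exists y; split => //; apply: nB.
Qed.

Lemma closed_autP (A : set treeAut) : closed A <->
  forall x, (forall n, exists2 y, A y & same_upto n x y) -> A x.
Proof.
split=> [Ac x Ax|h x /closure_autP]; last exact: h.
by apply: Ac; apply/closure_autP.
Qed.

Lemma aut_limit (u : nat -> treeAut) :
  (forall n, same_upto n (u n) (u n.+1)) ->
  exists x, forall n, same_upto n x (u n).
Proof.
move=> u1.
have um m n : m <= n -> same_upto m (u m) (u n).
  elim: n => [|n IH]; first by rewrite leqn0 => /eqP ->.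
  rewrite leq_eqVlt => /predU1P[-> //|]; rewrite ltnS => mn.
  by apply: same_upto_trans (IH mn) _; apply: same_upto_leq (u1 n).
(* On a word [t] the sequence is constant from index [size t] on. *)
pose f t := u (size t) t.
have fE n t : size t <= n -> f t = u n t by move=> tn; apply: um.
have fP : is_tree_aut f.
  split; last 1 first.
  - move=> t v; pose n := maxn (size t) (size v).
    rewrite (fE n) ?leq_maxl// (fE n) ?leq_maxr//.
    by case: (aut_funP (u n)) => _ _; apply.
  - exists (fun t => (u (size t))^-1 t) => t; rewrite /f ?size_aut.
      by rewrite -autM mulVg.
    by rewrite -autM mulgV.
  - by rewrite /f aut_nil.
by exists (TreeAut fP) => n t tn; exact: fE.
Qed.

Lemma cvg_autP (u : nat -> treeAut) x :
  (forall n, exists N, forall m, N <= m -> same_upto n x (u m)) ->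
  u @ \oo --> x.
Proof.
move=> h A [n nA]; have [N Nn] := h n; exists N => // m /= Nm.
by apply: nA; exact: Nn.
Qed.

End SameUpto.

(** * Infinite products of diagonal elements *)

Lemma diag_seqS x i : diag_seq x i.+1 = aut_pair (diag_seq x i) (diag_seq x i).
Proof. by []. Qed.

Lemma diag_seq_pair x i : diag_seq (aut_pair x x) i = diag_seq x i.+1.
Proof. by rewrite /diag_seq iterSr. Qed.

Lemma diag_seqM x y i : diag_seq (x * y) i = diag_seq x i * diag_seq y i.
Proof. by elim: i => // i IH; rewrite !diag_seqS IH pairM. Qed.

Lemma diag_seq1 i : diag_seq 1 i = 1.
Proof. by elim: i => // i IH; rewrite diag_seqS IH pair11. Qed.

Lemma diag_seqX x n i : diag_seq (x ^+ n) i = diag_seq x i ^+ n.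
Proof.
elim: n => [|n IH]; first by rewrite diag_seq1.
by rewrite !expgS diag_seqM IH.
Qed.

Lemma same_upto_diag_seq x i : same_upto i (diag_seq x i) 1.
Proof.
elim: i => [|i IH]; first by case=> // _; rewrite !aut_nil.
by rewrite diag_seqS -pair11; exact: same_upto_pair.
Qed.

Lemma diag_seq_inj x i : diag_seq x i = 1 -> x = 1.
Proof.
elim: i => // i IH; rewrite diag_seqS => /(congr1 (sec^~ false)).
by rewrite sec_pair sec1; exact: IH.
Qed.

Lemma partial_prodSr w k n :
  partial_prod w k n.+1 = partial_prod w k n * w n.+1 ^+ k n.
Proof. by rewrite /partial_prod big_nat_recr. Qed.

(** Every factor is a diagonal pair, so one diagonal comes out of the whole product. This
    self-similarity drives [phi_diag] and [partial_prodM]. *)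
Lemma partial_prod_diag x (k : nat -> 'F_2) n :
  partial_prod (diag_seq x) k n.+1 =
  diag_seq (x ^+ k 0 * partial_prod (diag_seq x) (k \o succn) n) 1.
Proof.
rewrite /partial_prod big_nat_recl// diag_seqM diag_seqX; congr (_ * _).
rewrite (big_morph (diag_seq^~ 1%N) (fun u v => diag_seqM u v 1%N) (diag_seq1 1)).
by apply: eq_bigr => i _; rewrite diag_seqX.
Qed.

(** The factor with index [n.+1] acts trivially on words of length at most [n], so the partial
    products stabilize on each level. *)
Lemma phi_limit x (k : nat -> 'F_2) :
  (forall n, same_upto n (phi (diag_seq x) k) (partial_prod (diag_seq x) k n)) /\
  cvgn (partial_prod (diag_seq x) k).
Proof.
set u := partial_prod _ _.
have u1 n : same_upto n (u n) (u n.+1).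
  rewrite /u partial_prodSr -[X in same_upto _ X _]mulg1.
  apply: same_uptoM => //; apply/same_upto_sym; rewrite -diag_seqX.
  by apply: same_upto_leq (leqnSn n) _; exact: same_upto_diag_seq.
have [y yu] := aut_limit u1.
have uy : u @ \oo --> y.
  apply: cvg_autP => n; exists n => m nm; apply: same_upto_leq nm _; exact: yu.
split; last by apply/cvg_ex; exists y.
by rewrite /phi (cvg_lim treeAut_hausdorff uy).
Qed.

Lemma same_upto_eq (x y : treeAut) : (forall n, same_upto n x y) -> x = y.
Proof. by move=> xy; apply: treeAut_eq => t; exact: xy (size t) _ _. Qed.

Lemma phi_diag x (k : nat -> 'F_2) :
  phi (diag_seq x) k = diag_seq (x ^+ k 0 * phi (diag_seq x) (k \o succn)) 1.
Proof.
apply: same_upto_eq => n; apply: (same_upto_leq (leqnSn n)).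
have [kn _] := phi_limit x k; have [k'n _] := phi_limit x (k \o succn).
apply: same_upto_trans (kn n.+1) _; rewrite partial_prod_diag.
apply: same_upto_pair; apply: same_uptoM => //; exact: same_upto_sym.
Qed.

Lemma F2_cases (k : 'F_2) : k = 0%R \/ k = 1%R.
Proof. by case: k => -[|[|//]] ?; [left|right]; apply: val_inj. Qed.

Lemma expg_F2D (gT : groupType) (x : gT) (k l : 'F_2) :
  x * x = 1 -> x ^+ (k + l)%R = x ^+ k * x ^+ l.
Proof.
by move=> x2; case: (F2_cases k) => ->; case: (F2_cases l) => ->;
  rewrite /= ?mul1g ?mulg1 -?x2.
Qed.

Lemma left_coset_eqP (gT : groupType) (H : set gT) x y : subgroup H ->
  left_coset H x = left_coset H y <-> H (x^-1 * y).
Proof.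
move=> [H1 HM HV].
have sub u v : H (u^-1 * v) -> left_coset H v `<=` left_coset H u.
  move=> uv _ [h Hh <-]; exists (u^-1 * v * h); first exact: HM.
  by rewrite -mulgA mulVKg.
split=> [xy|xy].
  have : left_coset H y y by exists 1; rewrite ?mulg1.
  by rewrite -xy => -[h Hh <-]; rewrite mulKg.
apply/seteqP; split; last exact: sub.
by have := HV _ xy; rewrite invgM invgK; exact: sub.
Qed.

(** * Closed subgroups *)

Lemma generated_subgroup (gT : groupType) (S : set gT) : subgroup (generated S).
Proof.
split=> [K [[K1 _ _] _] //|x y Sx Sy K KS|x Sx K KS]; case: (KS) => -[K1 KM KV] _.
  by apply: KM; [exact: Sx | exact: Sy].
by apply: KV; exact: Sx.
Qed.

Lemma closure_subgroup (A : set treeAut) : subgroup A -> subgroup (closure A).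
Proof.
move=> [A1 AM AV]; split=> [|x y /closure_autP Ax /closure_autP Ay|x /closure_autP Ax].
- exact: subset_closure.
- apply/closure_autP => n; have [x' Ax' xx] := Ax n; have [y' Ay' yy] := Ay n.
  by exists (x' * y'); [exact: AM | exact: same_uptoM].
- apply/closure_autP => n; have [x' Ax' xx] := Ax n.
  by exists x'^-1; [exact: AV | exact: same_uptoV].
Qed.

Lemma closed_group_subgroup r a : subgroup (closed_group r a).
Proof. exact/closure_subgroup/generated_subgroup. Qed.

Lemma closed_group_closed r a : closed (closed_group r a).
Proof. exact: closed_closure. Qed.

Lemma closed_group_gen r a i : 1 <= i <= r -> closed_group r a (a i).
Proof. by move=> ir; apply: subset_closure; apply: sub_gen_smallest; exists i. Qed.

Lemma closed_group_min r a (K : set treeAut) : subgroup K -> closed K ->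
  (forall i, 1 <= i <= r -> K (a i)) -> closed_group r a `<=` K.
Proof.
move=> Ks Kc Ka; rewrite [X in _ `<=` X](closure_id K).1//.
by apply: closureS; apply: smallest_sub => // _ [i ir <-]; exact: Ka.
Qed.

Lemma closed_group_ind r a (K : set treeAut) :
  (forall i, 1 <= i <= r -> a i * a i = 1) -> closed K -> K 1 ->
  (forall i g, 1 <= i <= r -> K g -> K (a i * g)) -> closed_group r a `<=` K.
Proof.
move=> aa Kc K1 Ka g Gg.
(* Unlike [K], the set [S] is visibly a subgroup; it is closed because [K] is, and translating [1]
   by [g] gives the claim. *)
pose S := [set x | forall h, K h -> K (x * h) /\ K (x^-1 * h)].
suff /(_ _ Gg _ K1)[] : closed_group r a `<=` S by rewrite mulg1.
apply: closed_group_min.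
- split=> [h Kh|x y Sx Sy h Kh|x Sx h Kh].
  + by rewrite invg1 mul1g.
  + rewrite invgM -!mulgA; split; first by apply Sx; apply Sy.
    by apply Sy; apply Sx.
  + by rewrite invgK; have [] := Sx h Kh.
- apply/closed_autP => x Sx h Kh.
  split; apply/(closed_autP K).1 => // n; have [y Sy xy] := Sx n.
    by exists (y * h); [apply Sy | exact: same_uptoM].
  by exists (y^-1 * h); [apply Sy | apply: same_uptoM => //; exact: same_uptoV].
- by move=> i ir h Kh; rewrite (mulg1_eq (aa i ir)); split; exact: Ka.
Qed.

(** * The group G *)

Section Group.
Variables (r s : nat) (a : nat -> treeAut).
Hypotheses (s_ge2 : 2 <= s) (r_ge4 : 4 <= r) (ltsr : s < r).
Hypothesis a_rec : recursion r s a.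

Local Notation G := (closed_group r a).
Implicit Types (K : set treeAut).

Lemma a_1 : a 1 = aut_swap.
Proof. by case: a_rec. Qed.

Lemma a_s1 : a s.+1 = aut_pair (a s) (a r).
Proof. by case: a_rec. Qed.

Lemma a_succ i : 1 <= i < r -> i != s -> a i.+1 = aut_pair (a i) 1.
Proof. by case: a_rec => _ _ h ir /eqP si; rewrite h//; lia. Qed.

Let G1 : G 1. Proof. by case: (closed_group_subgroup r a). Qed.
Let GM x y : G x -> G y -> G (x * y).
Proof. by case: (closed_group_subgroup r a) => _ + _; apply. Qed.
Let GV x : G x -> G x^-1.
Proof. by case: (closed_group_subgroup r a) => _ _; apply. Qed.
Let GJ x y : G x -> G y -> G (x ^ y).
Proof. by move=> Gx Gy; rewrite conjgE; do 2?apply: GM => //; exact: GV. Qed.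
Let Ga i : 1 <= i <= r -> G (a i). Proof. exact: closed_group_gen. Qed.
Let G_swap : G aut_swap. Proof. by rewrite -a_1; apply: Ga; lia. Qed.
Let Gc x : (forall n, exists2 y, G y & same_upto n x y) -> G x.
Proof. by move/closed_autP: (@closed_group_closed r a); apply. Qed.

Lemma a_invol i : 1 <= i <= r -> a i * a i = 1.
Proof.
move=> ir; apply: treeAut_eq => t; elim: t i ir => [|b t IH] i ir.
  by rewrite aut_nil.
case: i ir => [//|[|i]] ir; first by rewrite a_1 swapK.
have [->|si] := eqVneq i.+1 s.
  by rewrite a_s1 pairM aut_pair_cons; case: b; rewrite IH//; lia.
by rewrite a_succ ?pairM ?mulg1 ?aut_pair_cons//; case: b; rewrite ?IH//; lia.
Qed.

(** The index [n] stands for level [n.+1]. In [a s.+1 = (a s, a r)] the second entry never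
    contributes, as its sign is taken on a level below [r]. *)
Lemma sgn_a n i : n < r -> 1 <= i <= r -> sgn n (a i) = (n.+1 == i).
Proof.
elim: n i => [|n IH] i nr ir.
  case: i ir => [//|[|i]] ir; first by rewrite a_1.
  by have [e|si] := eqVneq i.+1 s; [rewrite e a_s1 -e | rewrite a_succ].
case: i ir => [//|[|i]] ir; first by rewrite a_1 /= !sec_swap sgn1.
have [e|si] := eqVneq i.+1 s.
  by rewrite e a_s1 sgn_pair !IH//; lia.
by rewrite a_succ ?sgn_pair ?sgn1 ?IH//; lia.
Qed.

(** * Conjugation and left factors *)

Lemma closed_group_normal (K : set treeAut) : closed K ->
  (forall i k, 1 <= i <= r -> K k -> K (k ^ a i)) ->
  forall g k, G g -> K k -> K (k ^ g).
Proof.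
move=> Kc Ka g k Gg; move: g Gg k.
apply: closed_group_ind; first exact: a_invol.
- apply/closed_autP => x Sx k Kk; apply/(closed_autP K).1 => // n.
  have [y Sy xy] := Sx n; exists (k ^ y); first exact: Sy.
  exact: same_uptoJ.
- by move=> k Kk; rewrite conjg1.
- by move=> i g ir Sg k Kk; rewrite conjgM; apply: Sg; exact: Ka.
Qed.

(** Realises conjugation by a generator in the first coordinate, as [left_factor_normal] needs. The
    pair for [a r] is [a s.+1] conjugated by the swap. *)
Lemma a_lift i : 1 <= i <= r -> exists h, G (aut_pair (a i) h).
Proof.
move=> ir; have Gs1 : G (aut_pair (a s) (a r)) by rewrite -a_s1; apply: Ga; lia.
have [->|si] := eqVneq i s; first by exists (a r).
have [->|ri] := eqVneq i r; first by exists (a s); rewrite -pair_swap; exact: GJ.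
by exists 1; rewrite -a_succ//; [apply: Ga|]; lia.
Qed.

(** For [K = G] this is the group L; that its elements lie in [G] follows from [closed_group_secP].
    The construction is applied twice in [left_factor_comm], hence the general [K]. *)
Definition left_factor (K : set treeAut) : set treeAut := [set x | K (aut_pair x 1)].

Lemma left_factor_subgroup K : subgroup K -> subgroup (left_factor K).
Proof.
move=> [K1 KM KV]; rewrite /left_factor; split=> /= [|x y Kx Ky|x Kx].
- by rewrite pair11.
- by rewrite -(mulg1 1) -pairM; exact: KM.
- by rewrite -invg1 -pairV; exact: KV.
Qed.

Lemma left_factor_closed K : closed K -> closed (left_factor K).
Proof.
move=> /closed_autP Kc; apply/closed_autP => x Kx; apply: Kc => n.
have [y Ky xy] := Kx n; exists (aut_pair y 1) => //.
by apply: (same_upto_leq (leqnSn n)); exact: same_upto_pair.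
Qed.

Lemma left_factor_normal K : closed K ->
  (forall g k, G g -> K k -> K (k ^ g)) ->
  forall g k, G g -> left_factor K k -> left_factor K (k ^ g).
Proof.
move=> Kc Kn; apply: closed_group_normal; first exact: left_factor_closed.
move=> i k ir Kk; have [h Gh] := a_lift ir.
by have := Kn _ _ Gh Kk; rewrite pairJ /left_factor /= conj1g.
Qed.

(* Modulo a normal subgroup containing the swap, [(u, 1)] and [(1, u)] agree, and
   the latter commutes with [(v, 1)]. *)
Lemma commg_left_factor K u v : subgroup K ->
  (forall g k, G g -> K k -> K (k ^ g)) -> K aut_swap ->
  G (aut_pair u 1) -> G (aut_pair v 1) -> K [~ aut_pair u 1, aut_pair v 1].
Proof.
move=> [K1 KM KV] Kn Ks; set x := aut_pair u 1; set y := aut_pair v 1 => Gx Gy.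
pose l := x^-1 * x ^ aut_swap.
have Kl : K l.
  have -> : l = (aut_swap^-1 ^ x) * aut_swap by rewrite /l !conjgE !mulgA.
  by apply: KM => //; apply: Kn => //; exact: KV.
have xE : x = x ^ aut_swap * l^-1 by rewrite /l invgM invgK mulVKg.
have xy : (x ^ aut_swap) ^ y = x ^ aut_swap.
  by rewrite pair_swap pairJ conjg1 conj1g.
have -> : [~ x, y] = l * (l^-1) ^ y.
  by rewrite commgEl {2}xE conjMg xy /l !mulgA.
by apply: KM => //; apply: Kn => //; exact: KV.
Qed.

Local Notation L := (left_factor G).

Let Lsub : subgroup L.
Proof. by apply: left_factor_subgroup; exact: closed_group_subgroup. Qed.
Let Lc : closed L.
Proof. by apply: left_factor_closed; exact: closed_group_closed. Qed.
Let Ln g k : G g -> L k -> L (k ^ g).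
Proof.
apply: left_factor_normal; first exact: closed_group_closed.
by move=> *; exact: GJ.
Qed.

Let La i : 1 <= i < r -> i != s -> L (a i).
Proof. by move=> ir si; rewrite /left_factor /= -a_succ//; apply: Ga; lia. Qed.

Lemma left_factor_comm : L [~ a s, a r].
Proof.
have Lswap : L aut_swap by rewrite -a_1; apply: La; lia.
have [r_eq|r_neq] := eqVneq r s.+1.
  (* [a r] is [(a s, a r)], so the commutator has to be sought one level deeper,
     in the left factor of [L]; this needs [3 <= s]. *)
  have s_ge3 : 3 <= s by lia.
  have as_E : a s = aut_pair (a s.-1) 1 by rewrite -a_succ ?prednK//; lia.
  have as1_E : a s.-1 = aut_pair (a s.-2) 1.
    have {1}-> : s.-1 = s.-2.+1 by lia.
    by apply: a_succ; lia.
  have -> : [~ a s, a r] = aut_pair [~ a s.-1, a s] 1.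
    rewrite r_eq a_s1 {1}as_E 2!commgEl pairJ pairV pairM.
    by rewrite conj1g invg1 mulg1.
  have L's := left_factor_subgroup Lsub.
  have -> : aut_pair [~ a s.-1, a s] 1 =
      aut_pair [~ aut_pair (a s.-2) 1, aut_pair (a s.-1) 1] 1.
    by rewrite -as1_E -as_E.
  have L'n := left_factor_normal Lc Ln.
  apply: (commg_left_factor L's L'n); rewrite -?as1_E -?as_E; try by apply: Ga; lia.
  by rewrite /left_factor /= -a_1 -a_succ; [apply: La; lia|lia|lia].
(* Here both elements are pairs with trivial second entry, and [commg_left_factor] applies to [L]
   itself, which contains the swap. *)
have as_E : a s = aut_pair (a s.-1) 1 by rewrite -a_succ ?prednK//; lia.
have ar_E : a r = aut_pair (a r.-1) 1 by rewrite -a_succ ?prednK//; lia.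
rewrite as_E ar_E; apply: commg_left_factor => //; rewrite -?as_E -?ar_E.
  by apply: Ga; lia.
by apply: Ga; lia.
Qed.

(** * Signs modulo the left factor and membership in [G] *)

Local Notation ss := (sgn s.-1).
Local Notation sr := (sgn r.-1).

(** [sgn] counts levels from zero: [ss] and [sr] are the signs on words of length [s] and [r]. *)
Lemma ss_a i : 1 <= i <= r -> ss (a i) = (s == i).
Proof. by move=> ir; rewrite sgn_a ?prednK//; lia. Qed.
Lemma sr_a i : 1 <= i <= r -> sr (a i) = (r == i).
Proof. by move=> ir; rewrite sgn_a ?prednK//; lia. Qed.

Lemma sgn_as_ar :
  [/\ ss (a s) = true, ss (a r) = false, sr (a s) = false & sr (a r) = true].
Proof. by rewrite !ss_a ?sr_a ?eqxx; try lia; split => //; lia. Qed.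

(* Modulo [L], the group [G] is generated by the commuting involutions [a s] and
   [a r], and the signs read off the exponents. *)
Lemma left_factor_coset g : G g -> L (a s ^+ ss g * (a r ^+ sr g * g)).
Proof.
case: Lsub => L1 LM LV.
have as2 : a s * a s = 1 by apply: a_invol; lia.
have ar2 : a r * a r = 1 by apply: a_invol; lia.
have asK z : a s * (a s * z) = z by rewrite mulgA as2 mul1g.
have arK z : a r * (a r * z) = z by rewrite mulgA ar2 mul1g.
have Lc1 : L (a s * (a r * (a s * a r))).
  by have := left_factor_comm; rewrite commgEl conjgE (mulg1_eq as2) (mulg1_eq ar2).
have Lc2 : L (a r * (a s * (a r * a s))).
  by have := LV _ Lc1; rewrite !invgM (mulg1_eq as2) (mulg1_eq ar2) -!mulgA.
move: g; apply: closed_group_ind; first exact: a_invol.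
- apply/closed_autP => x Kx; apply/(closed_autP L).1 => // n.
  have [y Ky xy] := Kx (maxn n r).
  have xyn : same_upto n x y by apply: same_upto_leq xy; lia.
  exists (a s ^+ ss y * (a r ^+ sr y * y)) => //.
  have -> : ss x = ss y by apply: same_upto_sgn xy; lia.
  have -> : sr x = sr y by apply: same_upto_sgn xy; lia.
  by do 2 apply: same_uptoM => //.
- by rewrite !sgn1 !mulg1.
- move=> i g ir Lg; rewrite !sgnM ss_a// sr_a//.
  have [<-{i ir}|is_] := eqVneq s i.
    have -> : (r == s) = false by lia.
    (* When [a r] stands in between, moving [a s] past it costs the commutator or its inverse. *)
    case: (ss g) (sr g) Lg => -[]; rewrite /= ?mul1g ?asK// => Lg.
      by have := LM _ _ Lc2 Lg; rewrite -!mulgA asK arK.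
    by have := LM _ _ Lc1 Lg; rewrite -!mulgA arK.
  have [<-{i ir is_}|ir_] := eqVneq r i.
    by case: (sr g) Lg => /=; rewrite ?mul1g ?arK.
  rewrite !addFb.
  (* The remaining generators lie in [L]; pulling [a i] to the front conjugates it by an element of
     [G], which preserves [L]. *)
  have -> : a s ^+ ss g * (a r ^+ sr g * (a i * g)) =
     a i ^ (a s ^+ ss g * a r ^+ sr g)^-1 * (a s ^+ ss g * (a r ^+ sr g * g)).
    have cE p z : p * (a i * z) = a i ^ p^-1 * (p * z).
      by rewrite mulgA (conjgCV p) -mulgA.
    by rewrite [LHS]mulgA cE -(mulgA _ _ g).
  apply: LM => //; apply: Ln; last by apply: La; lia.
  apply: GV; apply: GM.
    by case: (ss g) => //=; apply: Ga; lia.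
  by case: (sr g) => //=; apply: Ga; lia.
Qed.

Lemma left_factor_sgn g : G g -> ss g = false -> sr g = false ->
  G (aut_pair g 1).
Proof.
by move=> Gg sg rg; have := left_factor_coset Gg; rewrite sg rg !mul1g.
Qed.

Lemma closed_group_pair u v : G u -> G v -> ss u = sr v -> sr u = ss v ->
  G (aut_pair u v).
Proof.
move=> Gu Gv uv vu.
have Gas : G (a s) by apply: Ga; lia.
have Gar : G (a r) by apply: Ga; lia.
(* [(p, q)] is a product of powers of [(a s, a r)] and [(a r, a s)], chosen so that [p] has the
   signs of [u] and [q] those of [v]. What remains in each coordinate has both signs zero. *)
pose p := a s ^+ ss u * a r ^+ sr u; pose q := a r ^+ ss u * a s ^+ sr u.
have Gp : G p by apply: GM; [case: (ss u)|case: (sr u)].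
have Gq : G q by apply: GM; [case: (ss u)|case: (sr u)].
have [ss1 ss0 sr0 sr1] := sgn_as_ar.
have Gpq : G (aut_pair p q).
  rewrite -pairM; apply: GM.
    case: (ss u) => /=; last by rewrite pair11.
    by rewrite -a_s1; apply: Ga; lia.
  case: (sr u) => /=; last by rewrite pair11.
  by rewrite -pair_swap; apply: GJ => //; rewrite -a_s1; apply: Ga; lia.
have -> : aut_pair u v =
    aut_pair (u * p^-1) 1 * aut_pair (v * q^-1) 1 ^ aut_swap * aut_pair p q.
  by rewrite pair_swap !pairM mulg1 mul1g !mulgVK.
apply: GM => //; apply: GM; last apply: GJ => //.
  by apply: left_factor_sgn; [apply: GM => //; exact: GV|..];
    rewrite sgnM sgnV sgnM !sgnX ?ss1 ?ss0 ?sr0 ?sr1 ?andbT ?andbF ?addbF ?addbb.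
apply: left_factor_sgn; [apply: GM => //; exact: GV|..];
  by rewrite sgnM sgnV sgnM !sgnX ?ss1 ?ss0 ?sr0 ?sr1 ?andbT ?andbF ?addbF ?uv ?vu ?addbb.
Qed.

(** Signs being locally constant, the conditions on the right define a closed subgroup, and it
    contains the generators. Conversely, [closed_group_pair] applies after removing a swap. *)
Lemma closed_group_secP x : G x <->
  [/\ G (sec x false), G (sec x true), ss (sec x false) = sr (sec x true) &
      sr (sec x false) = ss (sec x true)].
Proof.
split=> [Gx|[Gx0 Gx1 x01 x10]]; last first.
  have Gp := closed_group_pair Gx0 Gx1 x01 x10.
  suff -> : x = (if swapped x then aut_swap else 1) *
      aut_pair (sec x false) (sec x true) by apply: GM => //; case: ifP.
  apply: aut_eqP => [|b]; first by rewrite swappedM; case: (swapped x).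
  by rewrite secM sec_pair; case: (swapped x); rewrite ?sec_swap ?sec1 mul1g; case: b.
pose K : set treeAut := [set x | [/\ G (sec x false), G (sec x true),
  ss (sec x false) = sr (sec x true) & sr (sec x false) = ss (sec x true)]].
apply: (@closed_group_min r a K) Gx => {x}.
- split=> [|x y [x0 x1 x01 x10] [y0 y1 y01 y10]|x [x0 x1 x01 x10]].
  + by rewrite /K /= !sec1 !sgn1; split.
  + rewrite /K /= !secM !sgnM y01 y10.
    case: (swapped y) => /=; rewrite ?x01 ?x10; split => //; exact: GM.
  + rewrite /K /= !secV !sgnV.
    by case: (swapped x) => /=; rewrite ?x01 ?x10; split => //; exact: GV.
- apply/closed_autP => x Kx.
  have Gsec b : G (sec x b).
    apply: Gc => n; have [y [y0 y1 _ _] xy] := Kx n.+1; exists (sec y b).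
      by case: b.
    exact: same_upto_sec.
  (* One extra level, since passing to sections loses one. *)
  have [y [_ _ y01 y10] xy] := Kx r.+1.
  have sgnE n b : n < r -> sgn n (sec x b) = sgn n (sec y b).
    by move=> nr; apply: same_upto_sgn nr _; exact: same_upto_sec.
  by rewrite /K /= !sgnE; try lia; split.
- case=> [//|[|i]] ir; rewrite /K /=.
    by rewrite a_1 !sec_swap !sgn1; split.
  have Gi : G (a i.+1) by apply: Ga; lia.
  have [e|si] := eqVneq i.+1 s.
    rewrite e a_s1 !sec_pair !ss_a ?sr_a ?eqxx; try lia.
    by split; try lia; apply: Ga; lia.
  rewrite a_succ// !sec_pair !sgn1 ss_a ?sr_a; try lia.
  by split => //; lia.
Qed.

(** * The normalizer *)

Local Notation N := (normalizer G).

Lemma mem_normalizer x : N x <->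
  (forall g, G g -> G (g ^ x)) /\ (forall g, G g -> G (g ^ x^-1)).
Proof.
split=> [Nx|[Gx GxV]].
  split=> g Gg; first by rewrite -Nx; exists g.
  by move: Gg; rewrite -{1}Nx => -[h Gh <-]; rewrite conjgK.
apply/seteqP; split=> [_ [g Gg <-]|g Gg]; first exact: Gx.
by exists (g ^ x^-1); [exact: GxV | rewrite conjgKV].
Qed.

Lemma normalizer_subgroup : subgroup N.
Proof.
split=> [|x y /mem_normalizer[x1 x2] /mem_normalizer[y1 y2]|x /mem_normalizer[x1 x2]];
  apply/mem_normalizer.
- by split=> g Gg; rewrite ?invg1 conjg1.
- by split=> g Gg; rewrite ?invgM conjgM; [apply: y1; exact: x1|apply: x2; exact: y2].
- by split=> // g Gg; rewrite invgK; exact: x1.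
Qed.

Let NM x y : N x -> N y -> N (x * y).
Proof. by case: normalizer_subgroup => _ + _; apply. Qed.
Let NV x : N x -> N x^-1.
Proof. by case: normalizer_subgroup => _ _; apply. Qed.
Let NJ x g : N x -> G g -> G (g ^ x).
Proof. by move=> /mem_normalizer[+ _]; apply. Qed.

Lemma sub_normalizer : G `<=` N.
Proof. by move=> x Gx; apply/mem_normalizer; split=> g Gg; apply: GJ => //; exact: GV. Qed.

Lemma normalizer_closed : closed N.
Proof.
apply/closed_autP => x Nx; apply/mem_normalizer; split=> g Gg; apply: Gc => n.
  have [y Ny xy] := Nx n; exists (g ^ y); first exact: NJ.
  exact: same_uptoJ.
have [y Ny xy] := Nx n; exists (g ^ y^-1); first by apply: NJ => //; exact: NV.
by apply: same_uptoJ => //; exact: same_uptoV.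
Qed.

Lemma closed_group_diag g : G (aut_pair g g) <-> G g /\ ss g = sr g.
Proof.
split=> [/closed_group_secP|[Gg sg]]; last exact: closed_group_pair.
by rewrite !sec_pair => -[].
Qed.

Lemma sgn_diag n x : sgn n (aut_pair x x) = false.
Proof. by case: n => // n; rewrite sgn_pair addbb. Qed.

(** Conjugation by [(u, u)] conjugates both sections by [u] and keeps their signs, so the criterion
    of [closed_group_secP] is preserved. *)
Lemma normalizer_diag v : N v -> N (aut_pair v v).
Proof.
have h u g : N u -> G g -> G (g ^ aut_pair u u).
  move=> Nu /closed_group_secP[g0 g1 g01 g10].
  have secJ b : sec (g ^ aut_pair u u) b = sec g b ^ u.
    rewrite conjgE pairV !secM !swappedM !swapped_pair !sec_pair.
    by case: b (_ (+) _) => -[].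
  by apply/closed_group_secP; rewrite !secJ !sgnJ; split => //; exact: NJ.
move=> Nv; apply/mem_normalizer; split=> g; first exact: h.
by rewrite pairV; apply: h; exact: NV.
Qed.

(* Conjugating the swap by [(u, v)] shows that [d = u v^-1] lies in [G] and that
   [ss d = sr d], so that [(u, v) = (d, 1) (v, v)], where [(d, 1)] agrees modulo
   [G] with a power of [(a s, a s)]. *)
Lemma normalizer_diag_coset x : N x ->
  exists v g, [/\ N v, G g & x = aut_pair v v * g].
Proof.
move=> Nx.
wlog x0 : x Nx / swapped x = false => [wl|].
  case x0: (swapped x); last exact: wl.
  have [||v [g [Nv Gg xs]]] := wl (x * aut_swap).
  - by apply: NM => //; exact: sub_normalizer.
  - by rewrite swappedM x0.
  - exists v, (g * aut_swap); split => //; first exact: GM.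
    by rewrite mulgA -xs -mulgA swapK mulg1.
have xE := aut_pairE x0; set u := sec x false in xE; set v := sec x true in xE.
have Gas : G (a s) by apply: Ga; lia.
have Gar : G (a r) by apply: Ga; lia.
have [ss1 ss0 sr0 sr1] := sgn_as_ar.
have Nv : N v.
  have h y g : N y -> swapped y = false -> G g -> G (g ^ sec y true).
    (* [k] has the signs that make [(k, g)] an element of [G]; conjugating this pair isolates the
       second section of [y]. *)
    move=> Ny y0 Gg; pose k := a r ^+ ss g * a s ^+ sr g.
    have Gk : G k by apply: GM; [case: (ss g)|case: (sr g)].
    have Gkg : G (aut_pair k g).
      by apply: closed_group_pair => //; rewrite /k sgnM !sgnX ?ss1 ?ss0 ?sr0 ?sr1
        ?andbT ?andbF ?addbF.
    have := NJ Ny Gkg; rewrite {1}(aut_pairE y0) pairJ => /closed_group_secP[_ + _ _].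
    by rewrite sec_pair.
  apply/mem_normalizer; split=> g Gg; first exact: h.
  have -> : v^-1 = sec x^-1 true by rewrite secV x0.
  by apply: h => //; [exact: NV | rewrite swappedV].
pose d := u * v^-1.
(* The sections of the conjugated swap are [d^-1] and [d]. *)
have [Gd sd] : G d /\ ss d = sr d.
  have /closed_group_secP : G (aut_swap ^ x^-1) by apply: NJ => //; exact: NV.
  rewrite conjgE invgK xE pairV mulgA.
  rewrite !secM !swapped_pair !sec_pair !sec_swap !mulg1 /=.
  move=> [_ Gd ds _]; by split=> //; rewrite -ds -[RHS]sgnV invgM invgK.
pose e := ss d.
(* The power of [a s] balances the signs: [(d a_s^e, a_s^e)] meets the conditions of
   [closed_group_pair], and its product with [(v', v')] is [x]. *)
pose v' := a s ^+ e * v.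
exists v', (aut_pair (d * a s ^+ e) (a s ^+ e) ^ aut_pair v' v').
have Ge : G (a s ^+ e) by case: (e).
have Nv' : N v' by apply: NM => //; exact: sub_normalizer.
split => //.
  apply: NJ; first exact: normalizer_diag.
  apply: closed_group_pair => //; first exact: GM.
    by rewrite sgnM !sgnX ss1 sr0 -/e andbT addbb andbF.
  by rewrite sgnM !sgnX -sd -/e ss1 sr0 andbT andbF addbF.
have aeK : a s ^+ e * (a s ^+ e * v) = v.
  by rewrite mulgA; case: (e); rewrite /= ?mul1g// a_invol ?mul1g//; lia.
by rewrite conjgE mulVKg pairM xE -mulgA aeK mulgVK.
Qed.

(** The condition [ss g = sr g] lets the process be repeated inside diagonal pairs, by
    [closed_group_diag_seq]. Where it fails, splitting off a factor [a s] repairs it, since this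
    changes [ss] only. *)
Lemma normalizer_decomposition x : N x ->
  exists (k : 'F_2) v g, [/\ N v, G g, ss g = sr g & x = a s ^+ k * aut_pair v v * g].
Proof.
move=> /normalizer_diag_coset[v [g [Nv Gg ->]]].
have Gas : G (a s) by apply: Ga; lia.
have as2 : a s * a s = 1 by apply: a_invol; lia.
have [sg|/eqP sg] := eqVneq (ss g) (sr g).
  by exists 0%R, v, g; rewrite mul1g.
exists 1%R, v, (a s ^ aut_pair v v * g); split => //.
- by apply: GM => //; apply: NJ => //; exact: normalizer_diag.
- by rewrite !(sgnM _ _ g) !sgnJ ss_a ?sr_a; try lia; case: (ss g) (sr g) sg => -[] //=; lia.
- by rewrite expg1 conjgE -!mulgA mulVKg (mulgA (a s)) as2 mul1g.
Qed.

(** * The map phi *)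

Local Notation w := (diag_seq (a s)).

Let Gas : G (a s). Proof. by apply: Ga; lia. Qed.
Let as2 : a s * a s = 1. Proof. by apply: a_invol; lia. Qed.
Let GasX n : G (a s ^+ n).
Proof. by elim: n => // n IH; rewrite expgS; exact: GM. Qed.

Lemma normalizer_diag_seq v i : N v -> N (diag_seq v i).
Proof. by move=> Nv; elim: i => // i IH; exact: normalizer_diag. Qed.

Lemma normalizer_partial_prod (k : nat -> 'F_2) n : N (partial_prod w k n).
Proof.
elim: n => [|n IH]; first by rewrite /partial_prod big_geq//; exact: sub_normalizer.
rewrite partial_prodSr -diag_seqX; apply: NM => //.
by apply: normalizer_diag_seq; exact: sub_normalizer.
Qed.

Lemma normalizer_phi (k : nat -> 'F_2) : N (phi w k).
Proof.
have [kn _] := phi_limit (a s) k.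
apply: ((closed_autP N).1 normalizer_closed) => n.
by exists (partial_prod w k n); [exact: normalizer_partial_prod | exact: kn].
Qed.

Lemma sgn_partial_prod (k : nat -> 'F_2) m n : sgn n (partial_prod w k m) = false.
Proof.
case: m => [|m]; first by rewrite /partial_prod big_geq ?sgn1.
by rewrite partial_prod_diag; exact: sgn_diag.
Qed.

Lemma sgn_phi (k : nat -> 'F_2) n : sgn n (phi w k) = false.
Proof. by rewrite phi_diag; exact: sgn_diag. Qed.

(** After the first doubling every sign vanishes, so the sign condition persists. *)
Lemma closed_group_diag_seq g i : G g -> ss g = sr g -> G (diag_seq g i).
Proof.
move=> Gg sg; suff [] : G (diag_seq g i) /\ ss (diag_seq g i) = sr (diag_seq g i) by [].
elim: i => // i IH; rewrite diag_seqS !sgn_diag; split => //.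
exact/closed_group_diag.
Qed.

Lemma w_order2 i : w i <> 1 /\ w i ^+ 2 = 1.
Proof.
split=> [/diag_seq_inj as1|]; last by rewrite expg2 -diag_seqM as2 diag_seq1.
by have [] := sgn_as_ar; rewrite as1 sgn1.
Qed.

(** The tails have zero signs, so the diagonal criterion equates [ss] of the leading powers of [a s]
    with their [sr], which is zero. Hence the leading exponents agree. *)
Lemma phi_inj_step (k l : nat -> 'F_2) : G ((phi w k)^-1 * phi w l) ->
  k 0 = l 0 /\ G ((phi w (k \o succn))^-1 * phi w (l \o succn)).
Proof.
rewrite (phi_diag (a s) k : _ = aut_pair _ _) (phi_diag (a s) l : _ = aut_pair _ _).
rewrite pairV pairM => /closed_group_diag[].
rewrite !(sgnM, sgnV, sgn_phi) !addbF.
have [ss1 _ sr0 _] := sgn_as_ar.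
have sgnF2 n (b : 'F_2) : sgn n (a s ^+ b) = (b == 1%R) && sgn n (a s).
  by case: (F2_cases b) => -> //; rewrite sgn1.
rewrite !sgnF2 ss1 sr0 !andbF !andbT.
have [->|->] := F2_cases (k 0); have [->|->] := F2_cases (l 0) => //=.
  by rewrite !mul1g => kl _.
by rewrite invgM mulgA -(mulgA _^-1) (mulg1_eq as2) as2 mulg1 => kl _.
Qed.

Lemma phi_inj_mod (k l : nat -> 'F_2) : G ((phi w k)^-1 * phi w l) -> k = l.
Proof.
move=> kl; apply/funext => i; elim: i k l kl => [|i IH] k l /phi_inj_step[] //.
by move=> _ /IH.
Qed.

(** The defect from multiplicativity is a diagonal pair. Its entry lies in [G] by induction on the
    shifted sequences, and both signs of the entry vanish because the powers of [a s] cancel in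
    them. *)
Lemma partial_prodM (k l : nat -> 'F_2) n :
  G ((partial_prod w (k + l)%R n)^-1 * (partial_prod w k n * partial_prod w l n)).
Proof.
elim: n k l => [|n IH] k l; first by rewrite /partial_prod !big_geq// invg1 !mulg1.
have {IH} := IH (k \o succn) (l \o succn).
rewrite !partial_prod_diag.
set p := partial_prod w (k \o succn) n; set q := partial_prod w (l \o succn) n.
rewrite -[(k + l)%R \o succn]/((k \o succn) + (l \o succn))%R.
set pq := partial_prod w _ n => Gpq.
rewrite -[(k + l)%R 0%N]/(k 0%N + l 0%N)%R expg_F2D//.
set x := a s ^+ k 0; set y := a s ^+ l 0.
have Gy : G y by exact: GasX.
have x2 : x * x = 1 by rewrite /x; case: (F2_cases (k 0)) => ->; rewrite ?mulg1.
have y2 : y * y = 1 by rewrite /y; case: (F2_cases (l 0)) => ->; rewrite ?mulg1.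
rewrite -!diag_seqM.
have -> : (diag_seq (x * y * pq) 1)^-1 = diag_seq (x * y * pq)^-1 1 by rewrite /= pairV.
rewrite -diag_seqM; apply/closed_group_diag_seq; last first.
  rewrite !(sgnM, sgnV) !sgn_partial_prod !addbF.
  by rewrite [X in X (+) _ = _]addbC [in LHS]addbC; case: (ss x) (ss y) (sr x) (sr y) => -[] [] [].
(* Besides the defect of the tails there remains [y] times a conjugate of [y], which lies in [G]
   since [p] normalizes it. *)
have -> : (x * y * pq)^-1 * (x * p * (y * q)) =
    (y * y ^ p^-1) ^ pq * (pq^-1 * (p * q)).
  rewrite !invgM (mulg1_eq x2) (mulg1_eq y2) !conjgE invgK -!mulgA mulVKg mulKg.
  have xK z : x * (x * z) = z by rewrite mulgA x2 mul1g.
  by rewrite xK.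
apply: GM => //; apply: NJ; first exact: normalizer_partial_prod.
by apply: GM => //; apply: NJ => //; apply: NV; exact: normalizer_partial_prod.
Qed.

Lemma phiM (k l : nat -> 'F_2) :
  G ((phi w (k + l)%R)^-1 * (phi w k * phi w l)).
Proof.
apply: Gc => n; have limn m := (phi_limit (a s) m).1 n.
exists ((partial_prod w (k + l)%R n)^-1 * (partial_prod w k n * partial_prod w l n)).
  exact: partial_prodM.
by apply: same_uptoM; [exact: same_uptoV | exact: same_uptoM].
Qed.

Lemma phi_surj x : N x -> exists k : nat -> 'F_2, G ((phi w k)^-1 * x).
Proof.
move=> Nx.
have /choice[f fP] (y : treeAut) : exists kv : 'F_2 * treeAut, N y ->
    N kv.2 /\ exists g, [/\ G g, ss g = sr g & y = a s ^+ kv.1 * aut_pair kv.2 kv.2 * g].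
  have [Ny|nNy] := pselect (N y); last by exists (0%R, 1).
  have [k [v [g [Nv Gg sg yE]]]] := normalizer_decomposition Ny.
  by exists (k, v) => _; split=> //; exists g.
(* One diagonal is split off first because [phi] starts at [w 1 = (a s, a s)], not at [a s]. *)
have [v [g0 [Nv Gg0 xE]]] := normalizer_diag_coset Nx.
pose u := fix u i := if i is j.+1 then (f (u j)).2 else v.
pose k i := (f (u i)).1.
have Nu i : N (u i) by elim: i => //= i /fP[].
(* The middle factor is trivial on words of length at most [n.+1], so it disappears in the limit and
   leaves only the error [h] in [G]. *)
have xk n : exists2 h, G h & x = partial_prod w k n * diag_seq (u n) n.+1 * h.
  elim: n => [|n [h Gh xn]]; first by exists g0; rewrite // /partial_prod big_geq// mul1g.
  have [_ [g [Gg sg un]]] := fP _ (Nu n).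
  exists (diag_seq g n.+1 * h); first by apply: GM => //; exact: closed_group_diag_seq.
  rewrite xn un 2!diag_seqM diag_seqX diag_seq_pair partial_prodSr.
  by rewrite -!mulgA.
exists k; apply: Gc => n; have [h Gh ->] := xk n; exists h => //.
have limn := (phi_limit (a s) k).1 n.
rewrite -{2}(mul1g h) mulgA; apply: same_uptoM => //.
rewrite mulgA -(mulg1 1); apply: same_uptoM.
  by rewrite -(mulVg (partial_prod w k n)); apply: same_uptoM => //; exact: same_uptoV.
by apply: same_upto_leq (leqnSn n) _; exact: same_upto_diag_seq.
Qed.

End Group.

Theorem theorem3p6p12 (r s : nat) (a : nat -> treeAut)
    (hs : (2 <= s)%N) (hr : (4 <= r)%N) (hsr : (s < r)%N)
    (ha : recursion r s a) :
  let G : set treeAut := closed_group r a in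
  let N : set treeAut := normalizer G in
  let w : nat -> treeAut := diag_seq (a s) in
  (* the w_i, i >= 1, lie in N, have order two and converge to 1 *)
  (forall i, (1 <= i)%N -> N (w i) /\ (w i <> 1 /\ w i ^+ 2 = 1)) /\
  w @ \oo --> (1 : treeAut) /\
  (* phi is well defined, with values in N *)
  (forall k : nat -> 'F_2, cvgn (partial_prod w k) /\ N (phi w k)) /\
  (* k |-> phi(k) G is an isomorphism of groups onto N / G *)
  set_bij [set: nat -> 'F_2] (quotient N G)
    (fun k => left_coset G (phi w k)) /\
  (forall k l : nat -> 'F_2,
    left_coset G (phi w (k + l)%R) =
    coset_mul (left_coset G (phi w k)) (left_coset G (phi w l))).
Proof.
move=> G N w.
have Gs : subgroup G := closed_group_subgroup r a.
have Nphi k : N (phi w k) by exact: (normalizer_phi hs hr hsr ha).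
split=> [i _|]; last split; last split; last split.
- split; last exact: (w_order2 hs hr hsr ha).
  apply: (normalizer_diag_seq hs hr hsr ha); apply: sub_normalizer.
  by apply: closed_group_gen; rewrite ltnW// ltnW.
- apply: cvg_autP => n; exists n => m nm; apply: same_upto_leq nm _.
  exact/same_upto_sym/same_upto_diag_seq.
- by move=> k; split=> //; exact: (phi_limit (a s) k).2.
- split.
  + by move=> k _; exists (phi w k).
  + move=> k l _ _ /(left_coset_eqP _ _ Gs); exact: (phi_inj_mod hs hr hsr ha).
  + move=> _ [x Nx <-]; have [k kx] := phi_surj hs hr hsr ha Nx.
    by exists k => //; exact: (left_coset_eqP _ _ Gs).2 kx.
- move=> k l; rewrite (coset_mulE _ Gs (Nphi l)); apply/(left_coset_eqP _ _ Gs).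
  exact: (phiM hs hr hsr ha).
Qed.
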